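(* Let $A$ be an associative algebra over a field $\Bbbk$ with product $\cdot$, and let $X$ be a well-ordered linear basis of $A$. Then the set of polynomials $$M_{L,a,b}=L(a)*b-L(a)b+L(ab)-L(a\cdot b),$$ $$W_{L,a,b,u}=L(a)(bu)-(L(a)b)u+L(ab)u-L(a\cdot b)u,$$ where $L=L_{w_1,\dots,w_k}$ with $k\ge 0$ and $w_1,\dots,w_k\in U$, $a,b\in X$, $u\in U$, is a Gröbner–Shirshov basis (GSB) in $\mathrm{preAs}\langle X\rangle$.
   Context: A pre-associative (dendriform) algebra is a $\Bbbk$-linear space with two bilinear operations $\succ,\prec$ satisfying $x\succ(y\succ z)=(x\succ y)\succ z+(x\prec y)\succ z$, $x\succ(y\prec z)=(x\succ y)\prec z$, $x\prec(y\succ z)+x\prec(y\prec z)=(x\prec y)\prec z$. Put $x*y=x\succ y+x\prec y$ and $xy=x\succ y$. In terms of these operations the axioms are: $*$ is associative, $(a_1*a_2)a_3=a_1(a_2a_3)$, and $a_1(a_2*a_3)=(a_1a_2)*a_3-(a_1a_2)a_3+a_1(a_2a_3)$. $\mathrm{preAs}\langle X\rangle$ is the free pre-associative algebra generated by $X$. Words. $U=X^{**}$ is the set of all nonempty non-associative words in $X$ (with respect to the product $xy$), $|u|$ is the length of $u\in U$. $U^*$ is the set of all nonempty associative words $u_1*\dots*u_k$ ($k\ge 1$, $u_i\in U$) in the alphabet $U$, $|u_1*\dots*u_k|_*=k$, and $U^\#=U^*\cup\{\epsilon\}$, where $\epsilon$ is the empty word. $U^*$ is a linear basis of $\mathrm{preAs}\langle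 X\rangle$, which as an associative algebra under $*$ is identified with the free associative algebra $\mathrm{As}\langle U\rangle$; the subspace $\Bbbk U$ under $xy$ is the free non-associative algebra generated by $X$. Operators. For $w_1,\dots,w_k\in U$, $L_{w_1,\dots,w_k}(u)=w_1(w_2(\dots(w_ku)\dots))$, extended linearly to $\Bbbk U$; for $k=0$ it is the identity operator. For $a,b\in X$, $ab$ denotes the product in $\Bbbk U$, whereas $a\cdot b\in A$ is the product in $A$, written as a linear combination of elements of $X$ and so regarded as an element of $\Bbbk X\subset\Bbbk U$. Order. The well order on $X$ is extended to $U$ by induction on length: with $\mathrm{wt}(x)=(1,x)$ for $x\in X$ and $\mathrm{wt}(u_1u_2)=(|u_1u_2|,u_2,u_1)$, put $u\le v$ iff $\mathrm{wt}(u)\le\mathrm{wt}(v)$ lexicographically. The order on $U$ is extended to a fixed well order on $U^*$ that is monomial with respect to $*$ ($u\le v$ implies $w*u\le w*v$ and $u*w\le v*w$) and such that $|u|_*>1$, $|v|_*=1$ imply $u>v$ (e.g. deg-lex). For $0\ne f\in\mathrm{preAs}\langle X\rangle$, $\bar f\in U^*$ is its principal (greatest) word; $f$ is monic if the coefficient at $\bar f$ is $1$. The set $\hat S$. For a set $S$ of monic polynomials put $S_0=\{f\in S: |\bar f|_*=1\}$ (so $S_0\subset \Bbbk U$), $S_1=S\setminus S_0$, $S_0^{(0)}=S_0$, $S_0^{(k+1)}=\{vf,fv: f\in S_0^{(k)},v\in U\}$, $\hat S_0=\bigcup_{k\ge0}S_0^{(k)}$, $\hat S=\hat S_0\cup S_1$.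 Compositions of monic $f,g$: (C1) if $\bar f=w_1*\bar g*w_2$, $w_i\in U^\#$: $h=f-w_1*g*w_2$, relative to $w=\bar f$; (C2) if $\bar f=u*w_1$, $\bar g=w_2*u$ with $u,w_1,w_2\in U^*$: $h=w_2*f-g*w_1$, relative to $w=w_2*\bar f=\bar g*w_1$; (C3) if $|\bar g|_*=1$ and $\bar f=v*u*v'$ with $v,v'\in U^\#$, $u=(w_1\dots w_k\bar g w_1'\dots w'_{k'})\in U$ for some bracketing with respect to the product $xy$, $w_i,w_i'\in U$, $k+k'>0$: $h=f-v*(w_1\dots w_kgw'_1\dots w'_{k'})*v'$ (same bracketing), relative to $w=\bar f$; (C4) if $|\bar f|_*>1$ and $v\in U$: $h=fv$, relative to $w=\overline{fv}$; (C5) if $|\bar f|_*>1$ and $u\in U^*$: $h=uf$, relative to $w=\overline{uf}$. A composition $h$ of type (C1)–(C3) relative to $w$ is trivial modulo $S$ if $h=\sum_i\alpha_i w_i*s_i*w_i'$ (finite sum, possibly empty) with $\alpha_i\in\Bbbk$, $w_i,w_i'\in U^\#$, $s_i\in\hat S$ and $w_i*\bar s_i*w_i'<w$ for all $i$. A composition of type (C4)–(C5) relative to $w$ is trivial modulo $S$ if $h$ has such a presentation with $w_i*\bar s_i*w_i'\le w$ for all $i$ (in particular $h=0$ is trivial). $S$ is a Gröbner–Shirshov basis (GSB) in $\mathrm{preAs}\langle X\rangle$ if for all $f,g\in S$ every composition of type (C1)–(C5) is trivial modulo $S$. *)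

(* Defs.v *)
From HB Require Import structures.
From mathcomp Require Import all_boot all_order all_algebra sesquilinear.
From mathcomp Require Import finmap monalg.

Set Implicit Arguments.
Unset Strict Implicit.
Unset Printing Implicit Defensive.

Import Order.TTheory GRing.Theory.
Local Open Scope ring_scope.

Declare Scope preAs_scope.
Delimit Scope preAs_scope with preAs.
Local Open Scope preAs_scope.

Reserved Notation "x ≻ y" (at level 40, left associativity).
Reserved Notation "x ≺ y" (at level 40, left associativity).
Reserved Notation "x ⊛ y" (at level 40, left associativity).

(* [{malg k[K]}] is the vector space over [k] with basis [K]. *)
HB.lock Definition lext (k : fieldType) (K : choiceType) (V : lmodType k)
  (F : K -> V) (f : {malg k[K]}) : V := \sum_(w <- msupp f) f@_w *: F w.
Arguments lext {k K V} F f.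

Section LinearExtension.
Context {k : fieldType} {K : choiceType} {V : lmodType k}.
Implicit Type F : K -> V.

Lemma lextEw F (f : {malg k[K]}) (D : {fset K}) :
  (msupp f `<=` D)%fset -> lext F f = \sum_(w <- D) f@_w *: F w.
Proof.
move=> sD; rewrite lext.unlock; apply: big_fset_incl => // w _ wf.
by rewrite mcoeff_outdom // scale0r.
Qed.

Lemma lext_is_linear F : linear (lext F).
Proof.
move=> a f g; pose D := (msupp f `|` msupp g `|` msupp (a *: f + g))%fset.
have sf : (msupp f `<=` D)%fset.
  by apply/fsubsetP => w wf; rewrite !inE wf.
have sg : (msupp g `<=` D)%fset.
  by apply/fsubsetP => w wf; rewrite !inE wf orbT.
have sh : (msupp (a *: f + g) `<=` D)%fset.
  by apply/fsubsetP => w wf; rewrite !inE wf orbT.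
rewrite (lextEw F sf) (lextEw F sg) (lextEw F sh) scaler_sumr -big_split /=.
by apply: eq_bigr => w _; rewrite mcoeffD mcoeffZ scalerDl scalerA.
Qed.

HB.instance Definition _ F :=
  GRing.isLinear.Build k {malg k[K]} V *:%R (lext F) (lext_is_linear F).

Lemma lextU F w : lext F << w >> = F w.
Proof. by rewrite lext.unlock msuppU oner_eq0 big_seq_fset1 mcoeffUU scale1r. Qed.

Lemma malg_span (f : {malg k[K]}) : f = \sum_(w <- msupp f) f@_w *: << w >>.
Proof.
rewrite {1}[f]monalgE; apply: eq_bigr => w _; apply/malgP => v.
by rewrite mcoeffZ !mcoeffU mulrnAr mulr1.
Qed.

Lemma malg_ind (Q : {malg k[K]} -> Prop) :
  Q 0 -> (forall c w f, Q f -> Q (c *: << w >> + f)) -> forall f, Q f.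
Proof.
move=> Q0 QS f; rewrite [f]malg_span.
by elim: (enum_fset _) => [|w s IH]; rewrite ?big_nil ?big_cons //; apply: QS.
Qed.

Lemma lin_congr (c : k) (f f' g : V) : f = f' -> c *: f + g = c *: f' + g.
Proof. by move->. Qed.

End LinearExtension.

Section BilinearExtension.
Context {k : fieldType} {K K' : choiceType} {V : lmodType k}.
Implicit Type F : K -> K' -> V.

Definition bext F (f : {malg k[K]}) (g : {malg k[K']}) : V :=
  lext (fun u => lext (F u) g) f.

Lemma bext_is_bilinear F : bilinear_for *:%R *:%R (bext F).
Proof.
split=> [g a f f'|f a g g'] /=; first by rewrite /bext linearP.
rewrite /bext 3!(lextEw _ (fsubset_refl (msupp f))) scaler_sumr -big_split.
apply: eq_bigr => u _ /=; by rewrite linearP scalerDr !scalerA mulrC.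
Qed.

HB.instance Definition _ F :=
  bilinear_isBilinear.Build k {malg k[K]} {malg k[K']} V *:%R *:%R (bext F)
    (bext_is_bilinear F).

Lemma bextU F u v : bext F << u >> << v >> = F u v.
Proof. by rewrite /bext !lextU. Qed.

End BilinearExtension.

Record preassociative (k : fieldType) (V : lmodType k)
    (sc pr : {bilinear V -> V -> V}) : Prop := Preassociative {
  preas_sc : forall x y z, sc x (sc y z) = sc (sc x y) z + sc (pr x y) z;
  preas_scpr : forall x y z, sc x (pr y z) = pr (sc x y) z;
  preas_pr : forall x y z, pr x (sc y z) + pr x (pr y z) = pr (pr x y) z
}.

(* Nonempty non-associative words in X. *)
Inductive magma (X : Type) := Gen of X | App of magma X & magma X.

Section MagmaChoice.
Context (X : choiceType).

Fixpoint magma_encode (u : magma X) : GenTree.tree X :=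
  match u with
  | Gen x => GenTree.Leaf x
  | App u1 u2 => GenTree.Node 0 [:: magma_encode u1; magma_encode u2]
  end.

Fixpoint magma_decode (t : GenTree.tree X) : option (magma X) :=
  match t with
  | GenTree.Leaf x => Some (Gen x)
  | GenTree.Node _ [:: t1; t2] =>
      if (magma_decode t1, magma_decode t2) is (Some u1, Some u2)
      then Some (App u1 u2) else None
  | _ => None
  end.

Lemma magma_encodeK : pcancel magma_encode magma_decode.
Proof. by elim=> //= u1 -> u2 ->. Qed.

HB.instance Definition _ := Choice.copy (magma X) (pcan_type magma_encodeK).

End MagmaChoice.

Fixpoint mlen (X : Type) (u : magma X) : nat :=
  if u is App u1 u2 then mlen u1 + mlen u2 else 1.

(* Lexicographic comparison of wt(x) = (1, x) and
   wt(u1 u2) = (|u1 u2|, u2, u1); the second factor is compared first. *)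
Fixpoint magma_lt (d : Order.disp_t) (X : orderType d) (u v : magma X) : bool :=
  (mlen u < mlen v)%N || (mlen u == mlen v) &&
  match u, v with
  | Gen x, Gen y => (x < y)%O
  | App u1 u2, App v1 v2 =>
      magma_lt u2 v2 || (u2 == v2) && magma_lt u1 v1
  | _, _ => false
  end.

Definition magma_le (d : Order.disp_t) (X : orderType d) (u v : magma X) :=
  (u == v) || magma_lt u v.

(* The basis U^* of the free algebra; [wlen] is |.|_*, and the possibly empty
   words (elements of U^#) are plain sequences over U. *)
Definition word (X : choiceType) : predArgType :=
  {w : seq (magma X) | w != [::]}.

HB.instance Definition _ (X : choiceType) := Choice.on (word X).

Section Words.
Context {X : choiceType}.
Local Notation U := (magma X).

Definition wlen (w : word X) : nat := size (val w).

Definition letter (u : U) : word X := exist _ [:: u] isT.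

Lemma wcat_subproof (l : seq U) (w : word X) (r : seq U) :
  l ++ val w ++ r != [::].
Proof. by case: w => w /=; case: w => // u w _; case: l. Qed.

Definition wcat (l : seq U) (w : word X) (r : seq U) : word X :=
  exist _ (l ++ val w ++ r) (wcat_subproof l w r).

Definition wmul (u v : word X) : word X := wcat [::] u (val v).

End Words.

(* The free pre-associative algebra on X, realized on the space with basis U^*;
   its axioms and its universal property are [preAs_preassociative] and
   [preAs_free] below. *)
Definition preAs (k : fieldType) (X : choiceType) : predArgType :=
  {malg k[word X]}.

HB.instance Definition _ (k : fieldType) (X : choiceType) :=
  GRing.Lmodule.on (preAs k X).

HB.lock Definition mon (k : fieldType) (X : choiceType) (w : word X) :
  preAs k X := << w >>.
Arguments mon {k X} w.

Definition monU {k : fieldType} {X : choiceType} (u : magma X) : preAs k X :=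
  mon (letter u).

HB.lock Definition star (k : fieldType) (X : choiceType) :
    preAs k X -> preAs k X -> preAs k X :=
  bext (fun u v => mon (wmul u v)).
Arguments star {k X} f g : rename.
Notation "f ⊛ g" := (star f g) : preAs_scope.

(* f ≻ l for a letter l: (u_1 * ... * u_m) ≻ l = u_1(u_2(...(u_m l)...)),
   since (a_1 * a_2) a_3 = a_1 (a_2 a_3). *)
Definition succ_letter {k : fieldType} {X : choiceType} (l : magma X)
    (f : preAs k X) : preAs k X :=
  lext (fun w : word X => monU (foldr (@App X) l (val w))) f.

(* u ≻ (u_1 * ... * u_m) for a letter u, by recursion on the reversed word
   [:: u_m; ...; u_1]. The step is the axiom
   a_1 (a_2 * a_3) = (a_1 a_2) * a_3 - (a_1 a_2) a_3 + a_1 (a_2 a_3)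
   with a_1 = u, a_2 = u_1 * ... * u_(m-1) and a_3 = u_m; for m = 1 its first
   two terms vanish and it yields the letter u u_1. *)
Fixpoint letter_succ_rev {k : fieldType} {X : choiceType} (u : magma X)
    (r : seq (magma X)) : preAs k X :=
  if r is l :: r' then
    letter_succ_rev u r' ⊛ monU l - succ_letter l (letter_succ_rev u r')
      + monU (App u (foldr (@App X) l (rev r')))
  else 0.

Definition letter_succ {k : fieldType} {X : choiceType} (u : magma X)
    (f : preAs k X) : preAs k X :=
  lext (fun w : word X => letter_succ_rev u (rev (val w))) f.

HB.lock Definition succ (k : fieldType) (X : choiceType) :
    preAs k X -> preAs k X -> preAs k X :=
  bext (fun u v : word X => foldr letter_succ (mon v) (val u)).
Arguments succ {k X} f g : rename.
Notation "f ≻ g" := (succ f g) : preAs_scope.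

Definition prec {k : fieldType} {X : choiceType} (f g : preAs k X) :=
  f ⊛ g - f ≻ g.
Notation "f ≺ g" := (prec f g) : preAs_scope.

Section PreAsTheory.
Context {k : fieldType} {X : choiceType}.
Local Notation U := (magma X).
Local Notation P := (preAs k X).

Lemma star_is_bilinear : bilinear_for *:%R *:%R (star : P -> P -> P).
Proof. rewrite star.unlock; exact: bext_is_bilinear. Qed.

HB.instance Definition _ :=
  bilinear_isBilinear.Build k P P P *:%R *:%R star star_is_bilinear.

Lemma succ_is_bilinear : bilinear_for *:%R *:%R (succ : P -> P -> P).
Proof. rewrite succ.unlock; exact: bext_is_bilinear. Qed.

HB.instance Definition _ :=
  bilinear_isBilinear.Build k P P P *:%R *:%R succ succ_is_bilinear.

Lemma prec_is_bilinear : bilinear_for *:%R *:%R (prec : P -> P -> P).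
Proof.
split=> [g a f f'|f a g g'] /=; rewrite /prec.
  by rewrite !linearPl /= scalerBr opprD addrACA.
by rewrite !linearPr /= scalerBr opprD addrACA.
Qed.

HB.instance Definition _ :=
  bilinear_isBilinear.Build k P P P *:%R *:%R prec prec_is_bilinear.

HB.instance Definition _ l := GRing.Linear.copy (succ_letter l : P -> P)
  (lext (fun w : word X => monU (foldr (@App X) l (val w)) : P)).

HB.instance Definition _ u := GRing.Linear.copy (letter_succ u : P -> P)
  (lext (fun w : word X => letter_succ_rev u (rev (val w)) : P)).

Lemma lext_mon (V : lmodType k) (F : word X -> V) (w : word X) :
  lext F (mon w : P) = F w.
Proof. by rewrite mon.unlock lextU. Qed.

Lemma star_mon (u v : word X) : mon u ⊛ mon v = mon (wmul u v) :> P.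
Proof. by rewrite star.unlock mon.unlock bextU. Qed.

Lemma wmulA : associative (@wmul X).
Proof. by move=> u v w; apply: val_inj; rewrite /= catA. Qed.

Lemma preAs_ind (Q : P -> Prop) :
  Q 0 -> (forall c (w : word X) f, Q f -> Q (c *: mon w + f)) ->
  forall f, Q f.
Proof. by rewrite mon.unlock => Q0 QS f; exact: (malg_ind Q0 QS). Qed.

Lemma lin3 (c : k) (a b p x y z : P) :
  (c *: a + x) - (c *: b + y) + (c *: p + z) =
  c *: (a - b + p) + (x - y + z).
Proof. by rewrite opprD [X in X + _]addrACA [LHS]addrACA scalerDr scalerBr. Qed.

Lemma starA : associative (star : P -> P -> P).
Proof.
move=> f g h; elim/preAs_ind: f => [|c u f IH]; first by rewrite !linear0l.
rewrite !linearPl /= IH; apply: lin_congr.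
elim/preAs_ind: g {f IH} => [|d v g IH].
  by rewrite linear0r !linear0l linear0r.
rewrite linearPl !linearPr linearPl /= IH; apply: lin_congr.
elim/preAs_ind: h {g IH} => [|e w h IH]; first by rewrite !linear0r.
by rewrite !linearPr /= IH !star_mon wmulA.
Qed.

Lemma succ_word (u : word X) (f : P) : mon u ≻ f = foldr letter_succ f (val u).
Proof.
elim/preAs_ind: f => [|d v f IH].
  by rewrite linear0r; elim: (val u) => //= l s <-; rewrite linear0.
have -> : foldr letter_succ (d *: mon v + f) (val u) =
    d *: foldr letter_succ (mon v) (val u) + foldr letter_succ f (val u).
  by elim: (val u) => //= l s ->; rewrite (linearP (letter_succ l)).
rewrite linearPr /= IH; apply: lin_congr.
by rewrite succ.unlock mon.unlock bextU.
Qed.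

Lemma succ_letter_mon (u : U) (f : P) : monU u ≻ f = letter_succ u f.
Proof. exact: succ_word. Qed.

Lemma succ_star (f g h : P) : (f ⊛ g) ≻ h = f ≻ (g ≻ h).
Proof.
elim/preAs_ind: f => [|c u f IH]; first by rewrite !linear0l.
rewrite !linearPl /= IH; apply: lin_congr.
elim/preAs_ind: g {f IH} => [|d v g IH].
  by rewrite linear0r !linear0l linear0r.
rewrite linearPr !linearPl linearPr /= IH; apply: lin_congr.
by rewrite star_mon !succ_word /= foldr_cat.
Qed.

Lemma succ_monU (u v : U) : monU u ≻ monU v = monU (App u v) :> P.
Proof.
by rewrite succ_letter_mon /letter_succ lext_mon /= linear0l linear0 subr0 add0r.
Qed.

Lemma succ_letterE (f : P) (l : U) : f ≻ monU l = succ_letter l f.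
Proof.
elim/preAs_ind: f => [|c u f IH]; first by rewrite linear0l linear0.
rewrite linearPl linearP /= IH; apply: lin_congr.
rewrite succ_word /succ_letter lext_mon; elim: (val u) => //= v s ->.
by rewrite -succ_letter_mon succ_monU.
Qed.

Lemma word_indl (Q : P -> Prop) :
  (forall u, Q (monU u)) ->
  (forall u (w : word X), Q (mon w) -> Q (monU u ⊛ mon w)) ->
  forall w : word X, Q (mon w).
Proof.
move=> Q1 QS [w wP]; case: w wP => // u s; elim: s u => [|v s IH] u H.
  have -> : exist (fun w => w != [::]) [:: u] H = letter u by apply: val_inj.
  exact: Q1.
have -> : exist (fun w => w != [::]) [:: u, v & s] H =
    wmul (letter u) (exist (fun w => w != [::]) (v :: s) isT).
  by apply: val_inj.
by rewrite -star_mon; apply: QS.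
Qed.

Lemma word_indr (Q : P -> Prop) :
  (forall u, Q (monU u)) ->
  (forall (w : word X) u, Q (mon w) -> Q (mon w ⊛ monU u)) ->
  forall w : word X, Q (mon w).
Proof.
move=> Q1 QS [w wP]; case/lastP: w wP => // s u.
elim/last_ind: s u => [|s v IH] u H.
  have -> : exist (fun w => w != [::]) [:: u] H = letter u by apply: val_inj.
  exact: Q1.
have H' : rcons s v != [::] by rewrite -size_eq0 size_rcons.
have -> : exist (fun w => w != [::]) (rcons (rcons s v) u) H =
    wmul (exist (fun w => w != [::]) (rcons s v) H') (letter u).
  by apply: val_inj; rewrite /= cats1.
by rewrite -star_mon; apply: QS.
Qed.

Lemma letter_succ_starr_letter (u : U) (f : P) (l : U) :
  monU u ≻ (f ⊛ monU l) =
  (monU u ≻ f) ⊛ monU l - (monU u ≻ f) ≻ monU l + monU u ≻ (f ≻ monU l).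
Proof.
elim/preAs_ind: f => [|c w f IH].
  by rewrite !(linear0l, linear0r) subr0 addr0.
rewrite !(linearPl, linearPr) /= IH lin3; apply: lin_congr.
rewrite [mon w ≻ _]succ_letterE /succ_letter lext_mon succ_monU.
rewrite star_mon succ_letter_mon /letter_succ lext_mon /= rev_cat /= revK.
by rewrite [_ ≻ monU l]succ_letterE succ_letter_mon /letter_succ lext_mon.
Qed.

Lemma succ_starr_letter (f g : P) (l : U) :
  f ≻ (g ⊛ monU l) = (f ≻ g) ⊛ monU l - (f ≻ g) ≻ monU l + f ≻ (g ≻ monU l).
Proof.
elim/preAs_ind: f => [|c w f IH]; first by rewrite !linear0l subr0 addr0.
rewrite !linearPl /= IH lin3; apply: lin_congr.
move: w; apply: (word_indl (Q := fun f => f ≻ (g ⊛ monU l) =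
    (f ≻ g) ⊛ monU l - (f ≻ g) ≻ monU l + f ≻ (g ≻ monU l))) => [u|u w IHw].
  exact: letter_succ_starr_letter.
rewrite !succ_star IHw linearDr linearBr /= letter_succ_starr_letter.
by rewrite addrK.
Qed.

Lemma succ_starr (f g h : P) :
  f ≻ (g ⊛ h) = (f ≻ g) ⊛ h - (f ≻ g) ≻ h + f ≻ (g ≻ h).
Proof.
elim/preAs_ind: h f g => [f g|c w h IH f g].
  by rewrite !linear0r subr0 addr0.
rewrite !linearPr /= IH lin3; apply: lin_congr; move: w f g {h IH}.
apply: (word_indr (Q := fun h => forall f g, f ≻ (g ⊛ h) =
    (f ≻ g) ⊛ h - (f ≻ g) ≻ h + f ≻ (g ≻ h))) => [l f g|w l].
  exact: succ_starr_letter.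
move: (mon w : P) => h IH f g.
rewrite (starA g h) (succ_starr_letter f (g ⊛ h)) IH.
rewrite (succ_starr_letter (f ≻ g) h) (succ_starr_letter g h).
rewrite linearDr linearBr /= (succ_starr_letter f (g ≻ h)).
rewrite linearDl linearBl linearDl linearBl /=.
rewrite (starA (f ≻ g) h) (succ_star (f ≻ g) h) (succ_star g h).
rewrite addrK !opprD !opprK -!addrA; congr (_ + (_ + _)).
by rewrite [LHS]addrCA [RHS]addrCA; congr (_ + _); rewrite addrCA.
Qed.

Lemma star_succ_prec (f g : P) : f ⊛ g = f ≻ g + f ≺ g.
Proof. by rewrite addrC subrK. Qed.

Lemma preAs_preassociative : preassociative (succ : {bilinear P -> P -> P}) prec.
Proof.
split=> f g h /=.
- by rewrite -succ_star star_succ_prec linearDl.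
- by rewrite /prec linearBr /= succ_starr addrK.
rewrite -linearDr /= -star_succ_prec /prec succ_starr.
rewrite starA !linearBl /= succ_star !opprD !opprK !addrA.
by rewrite addrAC.
Qed.

End PreAsTheory.

Section PreAsFree.
Context {k : fieldType} {X : choiceType}.
Local Notation P := (preAs k X).

Context {V : lmodType k} {sc pr : {bilinear V -> V -> V}}.
Hypothesis scpr : preassociative sc pr.
Variable phi : X -> V.

Let st x y := sc x y + pr x y.

Fixpoint preAs_evU (u : magma X) : V :=
  match u with
  | Gen x => phi x
  | App u1 u2 => sc (preAs_evU u1) (preAs_evU u2)
  end.

Fixpoint preAs_evs (u : magma X) (s : seq (magma X)) : V :=
  if s is v :: s' then st (preAs_evU u) (preAs_evs v s') else preAs_evU u.

Definition preAs_evw (w : word X) : V :=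
  if val w is u :: s then preAs_evs u s else 0.

Definition preAs_ev : P -> V := lext preAs_evw.

HB.instance Definition _ := GRing.Linear.copy preAs_ev (lext preAs_evw).

Let scst x y z : sc (st x y) z = sc x (sc y z).
Proof. by rewrite (preas_sc scpr) /st linearDl. Qed.

Let stA x y z : st x (st y z) = st (st x y) z.
Proof.
rewrite [RHS]/st -/(st x y) scst /st linearDr (preas_scpr scpr).
by rewrite linearDr (preas_pr scpr) linearDl /= addrA.
Qed.

Let scst_r x y z : sc x (st y z) = st (sc x y) z - sc (sc x y) z + sc x (sc y z).
Proof.
by rewrite /st linearDr (preas_scpr scpr) addrC [sc (sc x y) z + _]addrC addrK.
Qed.

Lemma preAs_ev_monU u : preAs_ev (monU u) = preAs_evU u.
Proof. exact: lext_mon. Qed.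

Lemma preAs_ev_starW (u v : word X) :
  preAs_evw (wmul u v) = st (preAs_evw u) (preAs_evw v).
Proof.
case: u v => -[//|u s] uP [[//|v t] vP]; rewrite /preAs_evw /=.
by elim: s u {uP} => //= w s IH u; rewrite IH stA.
Qed.

Lemma preAs_ev_star f g : preAs_ev (f ⊛ g) = st (preAs_ev f) (preAs_ev g).
Proof.
rewrite /st; elim/(@preAs_ind k X): f => [|c u f IH].
  by rewrite !(linear0l, linear0) addr0.
rewrite linearPl !linearP /= !linearPl /= IH addrACA -scalerDr.
apply: lin_congr => {f IH}.
elim/(@preAs_ind k X): g => [|d v g IH].
  by rewrite !(linear0r, linear0) addr0.
rewrite linearPr !linearP /= IH addrACA -scalerDr.
apply: lin_congr; rewrite star_mon /preAs_ev !lext_mon.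
exact: preAs_ev_starW.
Qed.

Lemma preAs_ev_succ_letter f l :
  preAs_ev (f ≻ monU l) = sc (preAs_ev f) (preAs_evU l).
Proof.
elim/(@preAs_ind k X): f => [|c u f IH]; first by rewrite !(linear0l, linear0).
rewrite linearPl !linearP linearPl /= IH; apply: lin_congr.
rewrite succ_letterE /succ_letter !lext_mon preAs_ev_monU.
rewrite /preAs_ev lext_mon /preAs_evw; case: u {f IH} => -[//|u s] _ /=.
by elim: s u => //= v s IH u; rewrite IH scst.
Qed.

Lemma preAs_ev_letter_succ u g :
  preAs_ev (monU u ≻ g) = sc (preAs_evU u) (preAs_ev g).
Proof.
elim/(@preAs_ind k X): g => [|d v g IH]; first by rewrite !(linear0r, linear0).
rewrite linearPr !linearP /= IH; apply: lin_congr; move: v {g IH d}.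
apply: (word_indr (Q := fun g =>
  preAs_ev (monU u ≻ g) = sc (preAs_evU u) (preAs_ev g))) => [v|w l IH].
  by rewrite succ_monU !preAs_ev_monU.
have E : preAs_evU (foldr (@App X) l (val w)) =
    sc (preAs_ev (mon w)) (preAs_evU l).
  by rewrite -preAs_ev_succ_letter succ_letterE /succ_letter lext_mon preAs_ev_monU.
rewrite succ_starr_letter linearD linearB /= !preAs_ev_star IH.
rewrite preAs_ev_succ_letter IH scst_r preAs_ev_monU; congr (_ + _).
by rewrite succ_letterE /succ_letter lext_mon succ_monU preAs_ev_monU /= E.
Qed.

Lemma preAs_ev_succ f g : preAs_ev (f ≻ g) = sc (preAs_ev f) (preAs_ev g).
Proof.
elim/(@preAs_ind k X): f g => [|c u f IH] g.
  by rewrite !(linear0l, linear0).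
rewrite linearPl !linearP linearPl /= IH; apply: lin_congr; move: u g {f IH c}.
apply: (word_indl (Q := fun f => forall g,
  preAs_ev (f ≻ g) = sc (preAs_ev f) (preAs_ev g))) => [u g|u w IH g].
  by rewrite preAs_ev_letter_succ preAs_ev_monU.
by rewrite succ_star preAs_ev_letter_succ IH preAs_ev_star scst preAs_ev_monU.
Qed.

End PreAsFree.

Theorem preAs_free (k : fieldType) (X : choiceType) (V : lmodType k)
    (sc pr : {bilinear V -> V -> V}) (phi : X -> V) :
  preassociative sc pr ->
  exists h : {linear preAs k X -> V},
    [/\ forall x, h (monU (Gen x)) = phi x,
        forall f g, h (f ≻ g) = sc (h f) (h g),
        forall f g, h (f ≺ g) = pr (h f) (h g)
      & forall h' : {linear preAs k X -> V},
          (forall x, h' (monU (Gen x)) = phi x) ->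
          (forall f g, h' (f ≻ g) = sc (h' f) (h' g)) ->
          (forall f g, h' (f ≺ g) = pr (h' f) (h' g)) -> h' =1 h].
Proof.
move=> scpr; exists (preAs_ev (sc := sc) (pr := pr) phi); split.
- by move=> x; apply: preAs_ev_monU.
- exact: preAs_ev_succ.
- move=> f g; rewrite /prec linearB /= preAs_ev_star // preAs_ev_succ //.
  by rewrite addrC addKr.
move=> h' h'X h'sc h'pr f; set h := preAs_ev _.
elim/(@preAs_ind k X): f => [|c w f IH]; first by rewrite !linear0.
rewrite !linearP /= IH; apply: lin_congr; move: w {f IH c}.
have hU u : h' (monU u) = h (monU u).
  rewrite /h preAs_ev_monU; elim: u => //= u IHu v IHv.
  by rewrite -succ_monU h'sc IHu IHv.
apply: (word_indl (Q := fun f => h' f = h f)) => // u w IH.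
rewrite /h preAs_ev_star // star_succ_prec linearD /= h'sc h'pr.
by rewrite hU IH.
Qed.

(* Possibly empty words act on both sides: l * f * r for l, r in U^#. *)
Definition wact {k : fieldType} {X : choiceType} (l : seq (magma X))
    (f : preAs k X) (r : seq (magma X)) : preAs k X :=
  lext (fun w : word X => mon (wcat l w r)) f.

Definition wlt {X : choiceType} (le : rel (word X)) (u v : word X) : bool :=
  (u != v) && le u v.

Record monomial_order (d : Order.disp_t) (X : orderType d)
    (le : rel (word X)) : Prop := MonomialOrder {
  mo_refl : reflexive le;
  mo_anti : antisymmetric le;
  mo_trans : transitive le;
  mo_total : total le;
  mo_wf : well_founded (wlt le);
  mo_mull : forall w u v, le u v -> le (wmul w u) (wmul w v);
  mo_mulr : forall w u v, le u v -> le (wmul u w) (wmul v w);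
  mo_letter : forall u v, le (letter u) (letter v) = magma_le u v;
  mo_wlen : forall u v, (1 < wlen u)%N -> wlen v = 1%N -> wlt le v u
}.

(* One-hole bracketings w_1 ... w_m [] w'_1 ... w'_m' with respect to xy: the
   hole is successively multiplied by elements of U on either side. *)
Inductive bracketing (X : Type) :=
| Hole
| BrL of magma X & bracketing X
| BrR of bracketing X & magma X.
Arguments Hole {X}.

Fixpoint plug (X : Type) (c : bracketing X) (u : magma X) : magma X :=
  match c with
  | Hole => u
  | BrL v c' => App v (plug c' u)
  | BrR c' v => App (plug c' u) v
  end.

Fixpoint plugP {k : fieldType} {X : choiceType} (c : bracketing X)
    (f : preAs k X) : preAs k X :=
  match c with
  | Hole => f
  | BrL v c' => monU v ≻ plugP c' f
  | BrR c' v => plugP c' f ≻ monU v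
  end.

Section GroebnerShirshov.
Context {k : fieldType} {X : choiceType}.
Variable le : rel (word X).
Local Notation U := (magma X).
Local Notation P := (preAs k X).
Implicit Types (S : P -> Prop) (f g h : P).

(* w is the principal word of f (so f != 0). *)
Definition lead f (w : word X) : Prop :=
  w \in msupp f /\ forall v, v \in msupp f -> le v w.

Definition is_monic f : Prop := exists2 w, lead f w & f@_w = 1.

Definition S0 S f : Prop := S f /\ exists2 w, lead f w & wlen w = 1%N.

Definition S1 S f : Prop := S f /\ ~ S0 S f.

Fixpoint S0_iter S (n : nat) f : Prop :=
  if n is n'.+1 then
    exists g (v : U), S0_iter S n' g /\ (f = monU v ≻ g \/ f = g ≻ monU v)
  else S0 S f.

Definition Shat S f : Prop := (exists n, S0_iter S n f) \/ S1 S f.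

Definition presentable S (bound : word X -> Prop) h : Prop :=
  exists (n : nat) (a : 'I_n -> k) (l r : 'I_n -> seq U) (s : 'I_n -> P),
    h = \sum_(i < n) a i *: wact (l i) (s i) (r i) /\
    forall i, Shat S (s i) /\
      exists2 w, lead (s i) w & bound (wcat (l i) w (r i)).

(* [composition f g h w]: h is a composition of f and g relative to w. *)
Inductive composition f g : P -> word X -> Prop :=
| InclusionComp wf wg (w1 w2 : seq U) of
    lead f wf & lead g wg & wf = wcat w1 wg w2 :
    composition f g (f - wact w1 g w2) wf
| IntersectionComp wf wg (u w1 w2 : word X) of
    lead f wf & lead g wg & wf = wmul u w1 & wg = wmul w2 u :
    composition f g (mon w2 ⊛ f - g ⊛ mon w1) (wmul w2 wf)
| LetterInclusionComp wf ug (v v' : seq U) (c : bracketing X) of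
    lead f wf & lead g (letter ug) & c <> Hole &
    wf = wcat v (letter (plug c ug)) v' :
    composition f g (f - wact v (plugP c g) v') wf.

Inductive mul_composition f : P -> Prop :=
| RightMulComp wf (v : U) of lead f wf & (1 < wlen wf)%N :
    mul_composition f (f ≻ monU v)
| LeftMulComp wf (u : word X) of lead f wf & (1 < wlen wf)%N :
    mul_composition f (mon u ≻ f).

Definition trivial_composition S h w : Prop :=
  presentable S (fun v => wlt le v w) h.

(* Here h is taken relative to its own principal word, which exists iff h != 0. *)
Definition trivial_mul_composition S h : Prop :=
  h = 0 \/ exists2 w, lead h w & presentable S (fun v => le v w) h.

Definition is_GSB S : Prop :=
  [/\ forall f, S f -> is_monic f,
      forall f g h w, S f -> S g -> composition f g h w ->
        trivial_composition S h w
    & forall f h, S f -> mul_composition f h -> trivial_mul_composition S h].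

End GroebnerShirshov.

Section LinearBasis.
Context {k : fieldType} {A : lmodType k} {X : choiceType}.

(* The family e is a basis: every element of A is exactly one linear combination
   of its members. *)
Definition linear_basis (e : X -> A) : Prop :=
  injective (lext e) /\ forall a, exists c : {malg k[X]}, lext e c = a.

Context {e : X -> A}.

Lemma coord_subproof (he : linear_basis e) a :
  exists c : {malg k[X]}, lext e c == a.
Proof. by have [c <-] := he.2 a; exists c. Qed.

Definition coord (he : linear_basis e) (a : A) : {malg k[X]} :=
  xchoose (coord_subproof he a).

Lemma coordK (he : linear_basis e) a : lext e (coord he a) = a.
Proof. exact/eqP/(xchooseP (coord_subproof he a)). Qed.

End LinearBasis.

Definition gen {k : fieldType} {X : choiceType} (x : X) : preAs k X :=
  monU (Gen x).

Definition Lop {k : fieldType} {X : choiceType} (ws : seq (magma X))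
    (f : preAs k X) : preAs k X :=
  foldr (fun w g => monU w ≻ g) f ws.

Section Relations.
Context {k : fieldType} {A : lmodType k} {X : choiceType} {e : X -> A}.
Variables (mul : A -> A -> A) (he : linear_basis e).
Local Notation P := (preAs k X).

(* The product of two basis elements of A, as an element of kX. *)
Definition dotX (a b : X) : P := lext gen (coord he (mul (e a) (e b))).

Definition Mpoly (ws : seq (magma X)) (a b : X) : P :=
  Lop ws (gen a) ⊛ gen b - Lop ws (gen a) ≻ gen b
  + Lop ws (gen a ≻ gen b) - Lop ws (dotX a b).

Definition Wpoly (ws : seq (magma X)) (a b : X) (u : magma X) : P :=
  Lop ws (gen a) ≻ (gen b ≻ monU u) - (Lop ws (gen a) ≻ gen b) ≻ monU u
  + Lop ws (gen a ≻ gen b) ≻ monU u - Lop ws (dotX a b) ≻ monU u.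

Definition MWset (f : P) : Prop :=
  (exists ws a b, f = Mpoly ws a b) \/ (exists ws a b u, f = Wpoly ws a b u).

End Relations.

(* Main.v *)
From HB Require Import structures.
Require Import Defs.
From mathcomp Require Import all_boot all_order all_algebra sesquilinear.
From mathcomp Require Import finmap monalg.
From mathcomp Require Import ring zify.

(* Every p in U is L(a) for a unique L and a in X. Let A operate
   linearly on kU from the right by a ◁ b = a.b and
   (w p) ◁ b = (w p) b - w (p b) + w (p ◁ b).
   Then the two families read M = p * b - p ◁ b and W = p (b u) - (p ◁ b) u,
   with principal words p * b and p (b u). Multiplying M on the right by v
   gives a W, and on the left by a letter gives another M, so (C4) and (C5) are
   trivial. The other compositions reduce to two facts about the ideal of kU
   generated by the W: it is stable under the action, and
   (p ◁ b) ◁ c = p ◁ (b.c) modulo the ideal. In both, the words involved are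
   bounded in length by |p| + 1 and |p| + 2, which is enough for the order. *)

Set Implicit Arguments.
Unset Strict Implicit.
Unset Printing Implicit Defensive.

Import GRing.Theory.
Local Open Scope ring_scope.
Local Open Scope preAs_scope.

(** * Linear spans as an inductive predicate *)

Section Span.
Context {k : fieldType}.

Inductive span {V : lmodType k} (G : V -> Prop) : V -> Prop :=
| span_zero : span G 0
| span_cons c g f of G g & span G f : span G (c *: g + f).

Lemma span_lin (V : lmodType k) (G : V -> Prop) c f g :
  span G f -> span G g -> span G (c *: f + g).
Proof.
elim=> [|a x y Gx _ IH] Gg; first by rewrite scaler0 add0r.
by rewrite scalerDr scalerA -addrA; apply: span_cons => //; apply: IH.
Qed.

Lemma span_gen (V : lmodType k) (G : V -> Prop) g : G g -> span G g.
Proof.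
move=> Gg; rewrite -[g]addr0 -[g]scale1r; apply: span_cons => //.
exact: span_zero.
Qed.

Lemma spanD (V : lmodType k) (G : V -> Prop) f g :
  span G f -> span G g -> span G (f + g).
Proof. by move=> Gf Gg; rewrite -[f]scale1r; apply: span_lin. Qed.

Lemma spanN (V : lmodType k) (G : V -> Prop) f : span G f -> span G (- f).
Proof.
by move=> Gf; rewrite -[- f]addr0 -scaleN1r; apply/span_lin/span_zero.
Qed.

Lemma spanB (V : lmodType k) (G : V -> Prop) f g :
  span G f -> span G g -> span G (f - g).
Proof. by move=> Gf /spanN; apply: spanD. Qed.

Lemma span_map (V W : lmodType k) (G : V -> Prop) (H : W -> Prop) (phi : V -> W) :
  linear phi -> forall f, span G f -> (forall g, G g -> span H (phi g)) ->
  span H (phi f).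
Proof.
move=> phiP f Gf GH; elim: Gf => [|c g {}f Gg _ IH].
  have := phiP (- 1) 0 0; rewrite scaler0 addr0 scaleN1r addNr => ->.
  exact: span_zero.
by rewrite phiP; apply: span_lin => //; apply: GH.
Qed.

Lemma span_bilinear (V V' W : lmodType k) (G : V -> Prop) (G' : V' -> Prop)
    (H : W -> Prop) (phi : {bilinear V -> V' -> W}) f f' :
  span G f -> span G' f' -> (forall g g', G g -> G' g' -> span H (phi g g')) ->
  span H (phi f f').
Proof.
move=> Gf Gf' GH; pose phil f := phi f f'.
have lphi : linear phil by move=> c x y; rewrite /phil linearPl.
apply: (span_map lphi Gf) => g Gg.
have rphi : linear (phi g) by move=> c x y; rewrite linearPr.
by apply: (span_map rphi Gf') => g' Gg'; apply: GH.
Qed.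

Lemma span_sub (V : lmodType k) (G H : V -> Prop) f :
  span G f -> (forall g, G g -> H g) -> span H f.
Proof.
move=> Gf GH; elim: Gf => [|c g h /GH Hg _].
  exact: span_zero.
exact: span_cons.
Qed.

End Span.

(** [presentable] indexes its terms by ordinals, so adding one term to a presentation means
    prepending an entry to each of its families. *)
Definition ord_cons (T : Type) (n : nat) (x : T) (F : 'I_n -> T) (i : 'I_n.+1) : T :=
  oapp F x (unlift ord0 i).

Lemma ord_cons0 (T : Type) (n : nat) (x : T) (F : 'I_n -> T) :
  ord_cons x F ord0 = x.
Proof. by rewrite /ord_cons unlift_none. Qed.

Lemma ord_consS (T : Type) (n : nat) (x : T) (F : 'I_n -> T) i :
  ord_cons x F (lift ord0 i) = F i.
Proof. by rewrite /ord_cons liftK. Qed.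

(** * Spans of words and of letters, and presentability *)

Section WordSpans.
Context {k : fieldType} {X : choiceType}.
Local Notation U := (magma X).
Local Notation P := (preAs k X).

(** In [wspan] and in [lspan] below, the predicate carries the bounds on words through all the
    computations, so that supports never have to be computed. *)
Definition wspan (B : word X -> Prop) : P -> Prop :=
  span (fun f => exists2 w, B w & f = mon w).

Definition lspan (B : U -> Prop) : P -> Prop :=
  span (fun f => exists2 u, B u & f = monU u).

Lemma lspan_monU (B : U -> Prop) u : B u -> lspan B (monU u).
Proof. by move=> Bu; apply: span_gen; exists u. Qed.

Lemma lspan_sub (B C : U -> Prop) f :
  lspan B f -> (forall u, B u -> C u) -> lspan C f.
Proof. by move=> Bf BC; apply: span_sub Bf _ => _ [u /BC Cu ->]; exists u. Qed.

Lemma lspan_wspan (B : U -> Prop) (C : word X -> Prop) f :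
  lspan B f -> (forall u, B u -> C (letter u)) -> wspan C f.
Proof.
by move=> Bf BC; apply: span_sub Bf _ => _ [u /BC Cu ->]; exists (letter u).
Qed.

Lemma lspan_succ (B C D : U -> Prop) f g :
  lspan B f -> lspan C g -> (forall u v, B u -> C v -> D (App u v)) ->
  lspan D (f ≻ g).
Proof.
move=> Bf Cg BCD.
apply: (span_bilinear (phi := succ) Bf Cg) => _ _ [u Bu ->] [v Cv ->].
by rewrite /= succ_monU; apply/lspan_monU/BCD.
Qed.

Lemma mcoeff_mon (w v : word X) : (mon w : P)@_v = (w == v)%:R.
Proof. by rewrite mon.unlock mcoeffU. Qed.

Lemma wspan_supp (B : word X -> Prop) f :
  wspan B f -> forall v, f@_v != 0 -> B v.
Proof.
elim=> [v|c _ g [w Bw ->] _ IH v]; first by rewrite mcoeff0 eqxx.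
rewrite mcoeffD mcoeffZ mcoeff_mon; have [<- //|_] := eqVneq w v.
by rewrite mulr0 add0r; apply: IH.
Qed.

(** Since [wlt] is strict, [w] does not occur in [f], so its coefficient stays 1. Both families get
    their principal words from this. *)
Lemma lead_below (le : rel (word X)) (w : word X) f :
  le w w -> wspan (fun v => wlt le v w) f ->
  lead le (mon w + f) w /\ (mon w + f)@_w = 1.
Proof.
move=> le_ww fP.
have fw : f@_w = 0.
  by apply/eqP/negPn/negP => /(wspan_supp fP); rewrite /wlt eqxx.
have cw : (mon w + f)@_w = 1 by rewrite mcoeffD mcoeff_mon eqxx fw addr0.
split=> //; split=> [|v]; rewrite -mcoeff_neq0 ?cw ?oner_eq0 //.
rewrite mcoeffD mcoeff_mon; have [<- //|_] := eqVneq w v; rewrite add0r.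
by move/(wspan_supp fP)/andP => [].
Qed.

Lemma wact_linear l r : linear (fun f : P => wact l f r).
Proof. by move=> c f g; apply: (linearP (lext _)). Qed.

Lemma wact_mon l w r : wact l (mon w : P) r = mon (wcat l w r).
Proof. exact: lext_mon. Qed.

Lemma wact_nil (f : P) : wact [::] f [::] = f.
Proof.
elim/(@preAs_ind k X): f => [|c w f IH]; first exact: (linear0 (lext _)).
rewrite wact_linear IH wact_mon; apply: lin_congr; congr mon.
by apply: val_inj; rewrite /= cats0.
Qed.

Lemma wact_rletter (f : P) u : wact [::] f [:: u] = f ⊛ monU u.
Proof.
elim/(@preAs_ind k X): f => [|c w f IH].
  by rewrite linear0l; apply: (linear0 (lext _)).
by rewrite wact_linear IH wact_mon linearPl /= star_mon.
Qed.

(** The presentations built below use elements of [Shat] without outer factors, so all [l i] and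
    [r i] can be empty. *)
Lemma presentable_span (le : rel (word X)) (S : P -> Prop) bound h :
  span (fun s => Shat le S s /\ exists2 w, lead le s w & bound w) h ->
  presentable le S bound h.
Proof.
have wcat_nil w : wcat [::] w [::] = w :> word X.
  by apply: val_inj; rewrite /= cats0.
elim=> [|c s {}h [Ss [w sw bw]] _ [n [a [l [r [t [-> tP]]]]]]].
  exists 0%N, (fun=> 0), (fun=> [::]), (fun=> [::]), (fun=> 0).
  by rewrite big_ord0; split=> // -[].
exists n.+1, (ord_cons c a), (ord_cons [::] l), (ord_cons [::] r), (ord_cons s t).
split=> [|i].
  rewrite big_ord_recl !ord_cons0 wact_nil.
  by under [in RHS]eq_bigr => i _ do rewrite !ord_consS.
case: (unliftP ord0 i) => [j|] ->; first by rewrite !ord_consS.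
by rewrite !ord_cons0; split=> //; exists w; rewrite ?wcat_nil.
Qed.

End WordSpans.

(** * The order on non-associative words *)

Section MagmaOrder.
Context {d : Order.disp_t} {X : orderType d}.
Implicit Types u v w : magma X.

Lemma magma_lt_irr u : magma_lt u u = false.
Proof.
elim: u => [x|u IHu v IHv] /=; first exact: Order.POrderTheory.ltxx.
by rewrite ltnn IHu IHv !andbF.
Qed.

Lemma magma_lt_mlen u v : (mlen u < mlen v)%N -> magma_lt u v.
Proof. by case: u v => [x|u1 u2] [y|v1 v2] //= ->. Qed.

Lemma mlen_magma_lt u v : magma_lt u v -> (mlen u <= mlen v)%N.
Proof.
by case: u v => [x|u1 u2] [y|v1 v2] //= /orP[/ltnW //|/andP[/eqP-> _]].
Qed.

(** After the length, the right factor is compared first. Hence a shorter right factor suffices as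
    soon as the total length does not grow; most order estimates below have this form. *)
Lemma magma_lt_AppE u1 u2 v1 v2 :
  (mlen (App u1 u2) <= mlen (App v1 v2))%N -> magma_lt u2 v2 ->
  magma_lt (App u1 u2) (App v1 v2).
Proof. by move=> /= le12 ->; rewrite andbT orbC -leq_eqVlt. Qed.

Lemma magma_lt_Appr w u v : magma_lt u v -> magma_lt (App w u) (App w v).
Proof.
by move=> uv; apply: magma_lt_AppE => //=; rewrite leq_add2l mlen_magma_lt.
Qed.

Lemma magma_lt_Appl w u v : magma_lt u v -> magma_lt (App u w) (App v w).
Proof.
move=> uv /=; rewrite uv eqxx orbT andbT orbC -leq_eqVlt leq_add2r.
exact: mlen_magma_lt.
Qed.

End MagmaOrder.

(** Descending along right factors ends at a generator. This lets an arbitrary [p] in U replace the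
    parameters L and a of the two families. *)
Lemma spine (X : Type) (u : magma X) : exists ws a, u = foldr (@App X) (Gen a) ws.
Proof.
elim: u => [a|u _ v [ws [a ->]]]; first by exists [::], a.
by exists (u :: ws), a.
Qed.

Lemma subr3 (V : zmodType) (a b c a' b' c' : V) :
  (a - b + c) - (a' - b' + c') = (a - a') - (b - b') + (c - c').
Proof. by rewrite !opprD addrACA [a - b + _]addrACA. Qed.

Lemma lin_swap (k : fieldType) (V : lmodType k) (b c : k) (u v x y : V) :
  b *: (c *: u + v) + (c *: x + y) = c *: (b *: u + x) + (b *: v + y).
Proof. by rewrite !scalerDr !scalerA mulrC addrACA. Qed.

(** * Bilinearity of the two products as rewriting rules *)

Section BilinearRules.
Context {k : fieldType} {X : choiceType}.
Implicit Types f g h : preAs k X.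

Lemma succPl c f g h : (c *: f + g) ≻ h = c *: (f ≻ h) + g ≻ h.
Proof. exact: linearPl. Qed.

Lemma succPr c f g h : f ≻ (c *: g + h) = c *: (f ≻ g) + f ≻ h.
Proof. exact: linearPr. Qed.

Lemma succDl f g h : (f + g) ≻ h = f ≻ h + g ≻ h.
Proof. exact: linearDl. Qed.

Lemma succDr f g h : f ≻ (g + h) = f ≻ g + f ≻ h.
Proof. exact: linearDr. Qed.

Lemma succBl f g h : (f - g) ≻ h = f ≻ h - g ≻ h.
Proof. exact: linearBl. Qed.

Lemma succBr f g h : f ≻ (g - h) = f ≻ g - f ≻ h.
Proof. exact: linearBr. Qed.

Lemma starPl c f g h : (c *: f + g) ⊛ h = c *: (f ⊛ h) + g ⊛ h.
Proof. exact: linearPl. Qed.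

Lemma starPr c f g h : f ⊛ (c *: g + h) = c *: (f ⊛ g) + f ⊛ h.
Proof. exact: linearPr. Qed.

Lemma starBl f g h : (f - g) ⊛ h = f ⊛ h - g ⊛ h.
Proof. exact: linearBl. Qed.

Lemma starBr f g h : f ⊛ (g - h) = f ⊛ g - f ⊛ h.
Proof. exact: linearBr. Qed.

End BilinearRules.

(** * The right action of A on kU *)

Section RightAction.
Context {k : fieldType} {A : lmodType k} {d : Order.disp_t} {X : orderType d}.
Context {mul : {bilinear A -> A -> A}} {e : X -> A} (he : linear_basis e).
Hypothesis mulA : associative mul.
Local Notation U := (magma X).
Local Notation P := (preAs k X).

(** The identification of A with kX, viewed inside kU. *)
Definition lin_gen (y : A) : P := lext gen (Defs.coord he y).
Local Notation g := lin_gen.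

Lemma lin_gen_is_linear : linear g.
Proof.
move=> c x y; rewrite /lin_gen.
have -> : Defs.coord he (c *: x + y) = c *: Defs.coord he x + Defs.coord he y.
  by have [e_inj _] := he; apply: e_inj; rewrite lext_is_linear !coordK.
exact: linearP.
Qed.

HB.instance Definition _ :=
  GRing.isLinear.Build k A P *:%R g lin_gen_is_linear.

Lemma lin_gen_basis x : g (e x) = monU (Gen x).
Proof.
rewrite /lin_gen; have -> : Defs.coord he (e x) = << x >>.
  by have [e_inj _] := he; apply: e_inj; rewrite coordK lextU.
by rewrite lextU.
Qed.

Lemma basis_ind (Q : A -> Prop) :
  Q 0 -> (forall c x y, Q y -> Q (c *: e x + y)) -> forall y, Q y.
Proof.
move=> Q0 QS y; rewrite -(coordK he y).
elim/(@malg_ind k X): (Defs.coord he y) => [|c x f].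
  by rewrite linear0.
by rewrite lext_is_linear lextU; apply: QS.
Qed.

Lemma lspan_lin_gen (B : U -> Prop) y : (forall x, B (Gen x)) -> lspan B (g y).
Proof.
move=> BG; elim/basis_ind: y => [|c x y IH].
  by rewrite linear0; apply: span_zero.
by rewrite linearP /= lin_gen_basis; apply: span_lin => //; apply: lspan_monU.
Qed.

(** This is [p ◁ y]. Here [y] runs over all of A, not only over the basis, so that the action of a
    product in A makes sense without structure constants. *)
Fixpoint ractU (y : A) (p : U) : P :=
  match p with
  | Gen a => g (mul (e a) y)
  | App w q => monU p ≻ g y - monU w ≻ (monU q ≻ g y) + monU w ≻ ractU y q
  end.

(* Extended by [0] to words that are not letters; [ract] is only meant for
   combinations of letters. *)
Definition ractW (y : A) (w : word X) : P :=
  if val w is [:: p] then ractU y p else 0.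

Definition ract (y : A) : P -> P := lext (ractW y).

HB.instance Definition _ y := GRing.Linear.copy (ract y) (lext (ractW y)).

Lemma ract_monU y p : ract y (monU p) = ractU y p.
Proof. by rewrite /ract lext_mon. Qed.

Lemma ractU_linear p : linear (ractU^~ p).
Proof.
move=> c y z; elim: p => [a|w _ p IH] /=; first by rewrite (linearPr mul) linearP.
by rewrite IH lin_gen_is_linear !succPr lin3.
Qed.

Lemma ractP y : linear (ract y).
Proof. exact: linearP. Qed.

Lemma ract0 y : ract y 0 = 0.
Proof. exact: linear0. Qed.

Lemma ractD y f h : ract y (f + h) = ract y f + ract y h.
Proof. exact: linearD. Qed.

Lemma ractB y f h : ract y (f - h) = ract y f - ract y h.
Proof. exact: linearB. Qed.

Lemma ract_linear f : linear (ract^~ f).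
Proof.
move=> c y z; elim/(@preAs_ind k X): f => [|b w f IH].
  by rewrite !ract0 scaler0 addr0.
rewrite !ractP IH.
have -> : ract (c *: y + z) (mon w) = c *: ract y (mon w) + ract z (mon w).
  rewrite /ract !lext_mon /ractW.
  by case: (val w) => [|p [|q s]]; rewrite ?scaler0 ?addr0 // ractU_linear.
exact: lin_swap.
Qed.

Definition letters : P -> Prop := lspan (fun=> True).

Lemma lettersP (B : U -> Prop) f : lspan B f -> letters f.
Proof. by move/lspan_sub; apply. Qed.

Lemma letters_monU p : letters (monU p).
Proof. exact: lspan_monU. Qed.

Lemma ract_lin_gen y z : ract z (g y) = g (mul y z).
Proof.
elim/basis_ind: y => [|c x y IH]; first by rewrite linear0l !linear0.
by rewrite linearPl !lin_gen_is_linear ractP IH lin_gen_basis ract_monU.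
Qed.

(** The recursion of [ractU], extended bilinearly from words to vectors of kU. *)
Lemma ract_succ y f h : letters f -> letters h ->
  ract y (f ≻ h) = (f ≻ h) ≻ g y - f ≻ (h ≻ g y) + f ≻ ract y h.
Proof.
move=> ff hh; elim: ff => [|c _ {}f [w _ ->] _ IH].
  by rewrite !linear0l ract0 subr0 addr0.
rewrite !succPl ractP IH lin3; apply: lin_congr => {f c IH}.
elim: hh => [|c _ {}h [p _ ->] _ IH].
  by rewrite linear0r ract0 !linear0l !linear0r subr0 addr0.
rewrite succPr !ractP !succPl !succPr IH.
rewrite lin3; apply: lin_congr.
by rewrite succ_monU ract_monU /= ract_monU.
Qed.

Definition short (n : nat) (u : U) : Prop := (mlen u <= n)%N.

Lemma lspan_short u : lspan (short (mlen u)) (monU u : P).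
Proof. by apply: lspan_monU; rewrite /short. Qed.

Lemma lspan_short_gen y : lspan (short 1) (g y).
Proof. exact: lspan_lin_gen. Qed.

Lemma lspan_eq (u : U) : lspan (eq u) (monU u : P).
Proof. exact: lspan_monU. Qed.

(** Acting lengthens a word by at most one: each of the three terms in the recursion has length at
    most [|p| + 1]. *)
Lemma lspan_ractU y p : lspan (short (mlen p).+1) (ractU y p).
Proof.
have gy := lspan_short_gen y.
elim: p => [a|w _ p IH] /=; first by apply: lspan_lin_gen.
apply: spanD; first apply: spanB.
- by apply: lspan_succ (lspan_short _) gy _ => u v; rewrite /short /=; lia.
- apply: lspan_succ (lspan_eq w) (lspan_succ (lspan_eq p) gy
      (D := short (mlen p).+1) _) _.
    by move=> _ v <-; rewrite /short /=; lia.
  by move=> _ v <-; rewrite /short /=; lia.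
by apply: lspan_succ (lspan_eq w) IH _ => _ v <-; rewrite /short /=; lia.
Qed.

Lemma lspan_ract (B C : U -> Prop) y f : lspan B f ->
  (forall p t, B p -> (mlen t <= (mlen p).+1)%N -> C t) -> lspan C (ract y f).
Proof.
move=> Bf BC; apply: (span_map (ractP y) Bf) => _ [p Bp ->].
by rewrite ract_monU; apply: lspan_sub (lspan_ractU y p) _ => t; apply: BC.
Qed.

(** * The ideal of kU generated by the W *)

Definition Wgen f y h : P := f ≻ (g y ≻ h) - ract y f ≻ h.
Definition Mgen f y : P := f ⊛ g y - ract y f.

(** The elements of [hat S_0] obtained from the W, each indexed by its principal letter, so that
    inversion on the index locates the reducible subword. *)
Inductive redex : U -> P -> Prop :=
| redexW p b u : redex (App p (App (Gen b) u)) (Wgen (monU p) (e b) (monU u))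
| redexL v t f of redex t f : redex (App v t) (monU v ≻ f)
| redexR t f v of redex t f : redex (App t v) (f ≻ monU v).

(** The part of the ideal reached by redexes whose principal letters satisfy [B]. *)
Definition rspan (B : U -> Prop) : P -> Prop :=
  span (fun f => exists2 t, B t & redex t f).

Lemma rspan_redex (B : U -> Prop) t f : B t -> redex t f -> rspan B f.
Proof. by move=> Bt ft; apply: span_gen; exists t. Qed.

Lemma rspan_eq t f : redex t f -> rspan (eq t) f.
Proof. exact: rspan_redex. Qed.

Lemma rspan_succl (B C D : U -> Prop) f h :
  rspan B f -> lspan C h -> (forall u v, B u -> C v -> D (App u v)) ->
  rspan D (f ≻ h).
Proof.
move=> Bf Ch BCD.
apply: (span_bilinear (phi := succ) Bf Ch) => {Bf}f _ [u Bu uf] [v Cv ->].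
exact: rspan_redex (BCD _ _ Bu Cv) (redexR _ uf).
Qed.

Lemma rspan_succr (B C D : U -> Prop) f h :
  lspan B f -> rspan C h -> (forall u v, B u -> C v -> D (App u v)) ->
  rspan D (f ≻ h).
Proof.
move=> Bf Ch BCD.
apply: (span_bilinear (phi := succ) Bf Ch) => _ {Ch}h [u Bu ->] [v Cv vh].
exact: rspan_redex (BCD _ _ Bu Cv) (redexL _ vh).
Qed.

Lemma subr_lin (c : k) (a b x y : P) :
  (c *: a + x) - (c *: b + y) = c *: (a - b) + (x - y).
Proof. by rewrite opprD addrACA scalerBr. Qed.

Lemma basis_span y : span (fun z => exists x, z = e x) y.
Proof.
elim/basis_ind: y => [|c x y IH]; first exact: span_zero.
by apply: span_cons => //; exists x.
Qed.

(** W is linear in each of its three arguments, so membership in the ideal need only be checked on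
    words and basis elements. *)
Lemma Wgen_linear1 y h : linear (fun f => Wgen f y h).
Proof.
by move=> c f f'; rewrite /Wgen ractP !succPl subr_lin.
Qed.

Lemma Wgen_linear2 f h : linear (fun y => Wgen f y h).
Proof.
move=> c y z; rewrite /Wgen lin_gen_is_linear ract_linear.
by rewrite !succPl succPr subr_lin.
Qed.

Lemma Wgen_linear3 f y : linear (Wgen f y).
Proof. by move=> c h h'; rewrite /Wgen !succPr subr_lin. Qed.

(** Here the middle generator stays [b], which permits a finer bound than in [rspan_Wgen], where
    expanding [y] may produce any generator. *)
Lemma rspan_Wgen_basis (B C D : U -> Prop) f b h :
  lspan B f -> lspan C h ->
  (forall p u, B p -> C u -> D (App p (App (Gen b) u))) ->
  rspan D (Wgen f (e b) h).
Proof.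
move=> Bf Ch BCD; apply: (span_map (Wgen_linear1 (e b) h) Bf) => _ [p Bp ->].
apply: (span_map (Wgen_linear3 (monU p) (e b)) Ch) => _ [u Cu ->].
exact: rspan_redex (BCD _ _ Bp Cu) (redexW _ _ _).
Qed.

Lemma rspan_Wgen (B C D : U -> Prop) f y h :
  lspan B f -> lspan C h ->
  (forall p x u, B p -> C u -> D (App p (App (Gen x) u))) ->
  rspan D (Wgen f y h).
Proof.
move=> Bf Ch BCD; apply: (span_map (Wgen_linear2 f h) (basis_span y)) => _ [x ->].
by apply: rspan_Wgen_basis Bf Ch _ => p u; apply: BCD.
Qed.

(** In [(p ◁ b) u] the total length is at most that of [p (b u)], while the right factor [u] is
    shorter than [b u]. The other two cases follow from monotonicity of the product. *)
Lemma redex_lead t f :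
  redex t f -> exists2 r, lspan (fun u => magma_lt u t) r & f = monU t + r.
Proof.
elim=> [p b u|v {}t {}f _ [r rt ->]|{}t {}f v _ [r rt ->]].
- exists (- (ract (e b) (monU p) ≻ monU u)).
    apply: spanN; rewrite ract_monU.
    apply: lspan_succ (lspan_ractU (e b) p) (lspan_eq u) _.
    move=> q _ + <-; rewrite /short => lq; apply: magma_lt_AppE.
      by rewrite /=; lia.
    by apply: magma_lt_mlen; rewrite /= add1n.
  by rewrite /Wgen lin_gen_basis !succ_monU.
- exists (monU v ≻ r); last by rewrite succDr succ_monU.
  apply: lspan_succ (lspan_eq v) rt _ => _ u <-.
  exact: magma_lt_Appr.
exists (r ≻ monU v); last by rewrite succDl succ_monU.
apply: lspan_succ rt (lspan_eq v) _ => u _ ut <-.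
exact: magma_lt_Appl.
Qed.

Lemma redex_short t f : redex t f -> lspan (short (mlen t)) f.
Proof.
case/redex_lead=> r rt ->; apply: spanD; first exact: lspan_short.
by apply: lspan_sub rt _ => u /mlen_magma_lt.
Qed.

(** The ideal is stable under the action. For a product with a redex this follows from [ract_succ]
    by induction; for W itself it rests on a direct identity. *)
Lemma redex_ract y t f : redex t f -> rspan (short (mlen t).+1) (ract y f).
Proof.
have gy := lspan_short_gen y; have gyL := lettersP gy.
elim=> [p b u|v {}t {}f ft IH|{}t {}f v ft IH].
- set T := ract (e b) (monU p); set B := g (e b).
  have pL := letters_monU p; have uL := letters_monU u.
  have BL : letters B by apply: lettersP (lspan_short_gen _).
  have TL : letters T by apply: lspan_ract pL _.
  have BuL : letters (B ≻ monU u) by apply: lspan_succ BL uL _.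
  (* Apply [ract_succ] to [p (b u)], then to the inner [b u]: the two terms [p ((b u) y)] cancel,
     and the rest groups into three W-expressions. *)
  have -> : ract y (Wgen (monU p) (e b) (monU u)) =
      Wgen (monU p) (e b) (monU u) ≻ g y - Wgen (monU p) (e b) (monU u ≻ g y)
      + Wgen (monU p) (e b) (ract y (monU u)).
    rewrite /Wgen -/B -/T ractB !ract_succ // succDr succBr !addrA subrK subr3.
    by rewrite succBl !addrA.
  apply: spanD; first apply: spanB.
  + apply: rspan_succl (rspan_Wgen _ (lspan_eq p) (lspan_eq u)
        (D := short (mlen p + (mlen u).+1)) _) gy _.
      by move=> _ x _ <- <-; rewrite /short /=; lia.
    by move=> w v; rewrite /short /=; lia.
  + apply: rspan_Wgen (lspan_eq p) (lspan_succ (lspan_eq u) gy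
        (D := short (mlen u).+1) _) _.
      by move=> _ v <-; rewrite /short /=; lia.
    by move=> _ x v <-; rewrite /short /=; lia.
  rewrite ract_monU; apply: rspan_Wgen (lspan_eq p) (lspan_ractU y u) _.
  by move=> _ x v <-; rewrite /short /=; lia.
- have vL := letters_monU v; have fL := lettersP (redex_short ft).
  rewrite ract_succ //; apply: spanD; first apply: spanB.
  + apply: rspan_succl (rspan_eq (redexL v ft)) gy _ => _ w <-.
    by rewrite /short /=; lia.
  + apply: rspan_succr (lspan_eq v) (rspan_succl (rspan_eq ft) gy
        (D := short (mlen t).+1) _) _.
      by move=> _ w <-; rewrite /short /=; lia.
    by move=> _ w <-; rewrite /short /=; lia.
  by apply: rspan_succr (lspan_eq v) IH _ => _ w <-; rewrite /short /=; lia.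
have vL := letters_monU v; have fL := lettersP (redex_short ft).
rewrite ract_succ //; apply: spanD; first apply: spanB.
- apply: rspan_succl (rspan_eq (redexR v ft)) gy _ => _ w <-.
  by rewrite /short /=; lia.
- apply: rspan_succl (rspan_eq ft) (lspan_succ (lspan_eq v) gy
      (D := short (mlen v).+1) _) _.
    by move=> _ w <-; rewrite /short /=; lia.
  by move=> _ w <-; rewrite /short /=; lia.
rewrite ract_monU; apply: rspan_succl (rspan_eq ft) (lspan_ractU y v) _.
by move=> _ w <-; rewrite /short /=; lia.
Qed.

(** * Associativity of the action modulo the ideal, and overlaps of redexes *)

Lemma ract_assoc_sum (a b c d1 e1 f h i j m n : P) :
  (a - b + c) - (d1 - e1 + (e1 - f + h)) + (i - j + m) - (c - h + n) =
  (f - j) - (b - (a - d1 + i)) + (m - n).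
Proof. by apply/malgP => v; rewrite !(mcoeffD, mcoeffN); ring. Qed.

(** Induction on [p]. On generators this is associativity of A; for [w p] the defect is [w] times
    the defect at [p], plus two elements coming from W with last argument [z]. *)
Lemma ract_assoc y z p :
  rspan (short (mlen p).+2) (ract z (ractU y p) - ractU (mul y z) p).
Proof.
have gy := lspan_short_gen y; have gz := lspan_short_gen z.
have gyL := lettersP gy; have gzL := lettersP gz.
elim: p => [a|w _ p IH].
  by rewrite /= ract_lin_gen mulA subrr; apply: span_zero.
have wL := letters_monU w; have pL := letters_monU p.
have pyL : letters (monU p ≻ g y) by apply: lspan_succ pL gyL _.
have wpL := letters_monU (App w p).
have TL : letters (ractU y p) by apply: lettersP (lspan_ractU y p).
have -> : ract z (ractU y (App w p)) - ractU (mul y z) (App w p) =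
    monU w ≻ Wgen (monU p) y (g z) - Wgen (monU (App w p)) y (g z)
    + monU w ≻ (ract z (ractU y p) - ractU (mul y z) p).
  rewrite /= ractD ractB !ract_succ // ract_lin_gen.
  rewrite succDr succBr ract_assoc_sum /Wgen !ract_monU /=.
  by rewrite !succBr succDl succBl.
apply: spanD; first apply: spanB.
- apply: rspan_succr (lspan_eq w) (rspan_Wgen _ (lspan_eq p) gz
      (D := short (mlen p).+2) _) _.
    by move=> _ x u <-; rewrite /short /=; lia.
  by move=> _ u <-; rewrite /short /=; lia.
- apply: rspan_Wgen (lspan_eq _) gz _ => _ x u <-.
  by rewrite /short /=; lia.
by apply: rspan_succr (lspan_eq w) IH _ => _ u <-; rewrite /short /=; lia.
Qed.

(** The critical pair at [p (b (c v))]. One reduction leads to [(p ◁ b) (c v)], the other to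
    [p ((b.c) v)]; one more W on each side gives [((p ◁ b) ◁ c) v] and [(p ◁ (b.c)) v], which agree
    modulo the ideal by [ract_assoc]. *)
Lemma redex_overlap_gen b c p v f :
  let u := App (Gen c) v in let t := App p (App (Gen b) u) in
  f = Wgen (monU (Gen b)) (e c) (monU v) ->
  rspan (fun s => magma_lt s t) (Wgen (monU p) (e b) (monU u) - monU p ≻ f).
Proof.
move=> u t ->.
have -> : Wgen (monU p) (e b) (monU u)
    - monU p ≻ Wgen (monU (Gen b)) (e c) (monU v) =
    Wgen (monU p) (mul (e b) (e c)) (monU v)
    - Wgen (ractU (e b) p) (e c) (monU v)
    - (ract (e c) (ractU (e b) p) - ractU (mul (e b) (e c)) p) ≻ monU v.
  rewrite /Wgen /= !lin_gen_basis !ract_monU /= !succBr !succBl.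
  rewrite !succ_monU -/u -/t.
  by apply/malgP => w; rewrite !(mcoeffD, mcoeffN); ring.
apply: spanB; first apply: spanB.
- apply: rspan_Wgen (lspan_eq p) (lspan_eq v) _ => _ x _ <- <-.
  by apply: magma_lt_mlen => /=; lia.
- apply: rspan_Wgen_basis (lspan_ractU (e b) p) (lspan_eq v) _.
  rewrite /short => q _ lq <-; apply: magma_lt_AppE; first by rewrite /=; lia.
  by apply: magma_lt_mlen => /=; lia.
apply: rspan_succl (ract_assoc _ _ _) (lspan_eq v) _.
rewrite /short => q _ lq <-; apply: magma_lt_AppE; first by rewrite /=; lia.
by apply: magma_lt_mlen => /=; lia.
Qed.

(** A second redex with principal letter [p (b u)] is the same W, meets it in [b (c v)], or lies
    inside [u] or inside [p]. In the last two cases the subword is replaced by its redex minus lower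
    terms. *)
Lemma redex_overlap p b u f : let t := App p (App (Gen b) u) in
  redex t f ->
  rspan (fun s => magma_lt s t) (Wgen (monU p) (e b) (monU u) - f).
Proof.
move=> t tf; inversion tf as [p' b' u' [Ep Eb Eu] Ef
  | v s h sh [Ev Es] Ef | s h v sh [Es Ev] Ef]; subst.
- by rewrite subrr; apply: span_zero.
- inversion sh as [p' c w [Ep' Eu] Eh | v s f uf [Ev Es] Eh
    | s f v bf [Es Ev] Eh]; subst.
  + exact: redex_overlap_gen.
  + have [r ru fE] := redex_lead uf.
    have uE : monU u = f - r by rewrite fE addrK.
    have -> : Wgen (monU p) (e b) (monU u) - monU p ≻ (monU (Gen b) ≻ f) =
        - Wgen (monU p) (e b) r - ract (e b) (monU p) ≻ f.
      rewrite uE /Wgen lin_gen_basis !succBr.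
      by apply/malgP => w; rewrite !(mcoeffD, mcoeffN); ring.
    apply: spanB; first apply: spanN.
      apply: rspan_Wgen_basis (lspan_eq p) ru _ => _ q <- qu.
      exact/magma_lt_Appr/magma_lt_Appr.
    rewrite ract_monU.
    apply: rspan_succr (lspan_ractU (e b) p) (rspan_eq uf) _.
    rewrite /short => q _ lq <-; apply: magma_lt_AppE; first by rewrite /=; lia.
    by apply: magma_lt_mlen => /=; lia.
  (* A generator is never the principal letter of a redex. *)
  by inversion bf.
have [r rp hE] := redex_lead sh.
have pE : monU p = h - r by rewrite hE addrK.
have -> : Wgen (monU p) (e b) (monU u) - h ≻ monU (App (Gen b) u) =
    - Wgen r (e b) (monU u) - ract (e b) h ≻ monU u.
  rewrite pE /Wgen lin_gen_basis ractB !succBl.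
  rewrite succ_monU.
  by apply/malgP => w; rewrite !(mcoeffD, mcoeffN); ring.
apply: spanB; first apply: spanN.
  apply: rspan_Wgen_basis rp (lspan_eq u) _ => q _ qp <-.
  exact: magma_lt_Appl.
(* A redex inside [p] leaves the term [(h ◁ b) u], which lies in the ideal because the ideal is
   stable under the action. *)
apply: rspan_succl (redex_ract (e b) sh) (lspan_eq u) _.
rewrite /short => q _ lq <-; apply: magma_lt_AppE; first by rewrite /=; lia.
by apply: magma_lt_mlen => /=; lia.
Qed.

Lemma redex_plug c t f : redex t f -> redex (plug c t) (plugP c f).
Proof.
by move=> tf; elim: c => [|v c IH|c IH v] //=; [apply: redexL | apply: redexR].
Qed.

(** * The families M and W expressed through the action *)

Lemma Lop_monU ws u : Lop ws (monU u) = monU (foldr (@App X) u ws) :> P.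
Proof. by elim: ws => //= w ws ->; rewrite succ_monU. Qed.

(** Along the spine the recursion telescopes: the product terms of intermediate levels cancel. *)
Lemma ractU_spine ws a b : ractU (e b) (foldr (@App X) (Gen a) ws) =
  Lop ws (gen a) ≻ gen b - Lop ws (gen a ≻ gen b) + Lop ws (dotX mul he a b).
Proof.
elim: ws => [|w ws IH] /=; first by rewrite subrr add0r.
rewrite IH lin_gen_basis !Lop_monU !succ_monU succDr succBr.
by rewrite succ_monU addrA addrA subrK.
Qed.

Lemma Mpoly_Mgen ws a b :
  Mpoly mul he ws a b = Mgen (monU (foldr (@App X) (Gen a) ws)) (e b).
Proof.
rewrite /Mpoly /Mgen ract_monU ractU_spine lin_gen_basis Lop_monU.
by rewrite opprD opprB !addrA addrAC [in RHS]addrAC; congr (_ - _); rewrite addrAC.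
Qed.

Lemma Wpoly_Wgen ws a b u :
  Wpoly mul he ws a b u =
  Wgen (monU (foldr (@App X) (Gen a) ws)) (e b) (monU u).
Proof.
rewrite /Wpoly /Wgen ract_monU ractU_spine lin_gen_basis Lop_monU.
rewrite succDl succBl.
by rewrite opprD opprB !addrA; congr (_ - _); rewrite addrAC.
Qed.

Lemma MWsetP f : MWset mul he f <->
  (exists p b, f = Mgen (monU p) (e b)) \/
  (exists p b u, f = Wgen (monU p) (e b) (monU u)).
Proof.
split=> [[[ws [a [b ->]]]|[ws [a [b [u ->]]]]]|[[p [b ->]]|[p [b [u ->]]]]].
- by left; rewrite Mpoly_Mgen; do 2?eexists.
- by right; rewrite Wpoly_Wgen; do 3?eexists.
- by left; have [ws [a ->]] := spine p; exists ws, a, b; rewrite Mpoly_Mgen.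
by right; have [ws [a ->]] := spine p; exists ws, a, b, u; rewrite Wpoly_Wgen.
Qed.

Lemma Mgen_linear1 y : linear (Mgen^~ y).
Proof.
by move=> c f f'; rewrite /Mgen starPl ractP subr_lin.
Qed.

Lemma Mgen_linear2 f : linear (Mgen f).
Proof.
by move=> c y z; rewrite /Mgen lin_gen_is_linear starPr ract_linear subr_lin.
Qed.

(** The recursion of [ractU] is chosen for this: it matches the axiom [u (p * y) = (u p) * y - (u p)
    y + u (p y)]. *)
Lemma succ_Mgen u p y : monU u ≻ Mgen (monU p) y = Mgen (monU (App u p)) y.
Proof.
rewrite /Mgen succBr succ_starr !ract_monU /= !succ_monU.
by apply/malgP => w; rewrite !(mcoeffD, mcoeffN); ring.
Qed.

Lemma Mgen_succ p b u :
  Mgen (monU p) (e b) ≻ monU u = Wgen (monU p) (e b) (monU u).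
Proof. by rewrite /Mgen succBl succ_star. Qed.

(** * Principal words of M, W and the redexes *)

Variable le : rel (word X).
Hypothesis hle : monomial_order le.
Local Notation S := (MWset mul he).
Local Notation lt := (wlt le).

Let le_refl := mo_refl hle.

Lemma lead_unique (f : P) v w : lead le f v -> lead le f w -> v = w.
Proof. by move=> [fv lv] [fw lw]; apply: (mo_anti hle); rewrite lw // lv. Qed.

Lemma wlt_letter u v : magma_lt u v -> lt (letter u) (letter v).
Proof.
move=> uv; rewrite /wlt (mo_letter hle) /magma_le uv orbT andbT.
by apply: contraTneq uv => -[->]; rewrite magma_lt_irr.
Qed.

Lemma wlt_mulr w u v : lt u v -> lt (wmul u w) (wmul v w).
Proof.
case/andP=> uv le_uv; rewrite /wlt (mo_mulr hle) // andbT.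
apply: contra uv => /eqP/(congr1 val) /= E; apply/eqP/val_inj.
have /eqP := E; rewrite eqseq_cat ?(eqxx (val w)) ?andbT => [/eqP //|].
by have := congr1 size E; rewrite !size_cat => /addIn.
Qed.

Lemma wlt_mull w u v : lt u v -> lt (wmul w u) (wmul w v).
Proof.
case/andP=> uv le_uv; rewrite /wlt (mo_mull hle) // andbT.
apply: contra uv => /eqP/(congr1 val) /= /eqP.
by rewrite eqseq_cat // eqxx /= => /eqP/val_inj ->.
Qed.

Lemma letter_wlt u w : (1 < wlen w)%N -> lt (letter u) w.
Proof. by move=> w1; apply: (mo_wlen hle). Qed.

Definition mword (p : U) (b : X) : word X := wmul (letter p) (letter (Gen b)).

Lemma wlen_wmul (u v : word X) : (1 < wlen (wmul u v))%N.
Proof.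
case: u v => [[//|x u] uP] [[//|y v] vP].
by rewrite /wlen /= size_cat addnS.
Qed.

Lemma wmul_mword u v p b :
  wmul u v = mword p b -> u = letter p /\ v = letter (Gen b).
Proof.
move/(congr1 val); case: u v => [[//|x u] uP] [[//|y v] vP] /= [->].
case: u uP => [uP [-> vE]|z [|? ?] //]; split; apply: val_inj => //=.
by rewrite vE.
Qed.

(** [p ◁ b] consists of letters, and these lie below every word with two letters. *)
Lemma Mgen_lead p b : let f := Mgen (monU p) (e b) in
  lead le f (mword p b) /\ f@_(mword p b) = 1.
Proof.
rewrite /= /Mgen lin_gen_basis ract_monU star_mon.
apply: lead_below => //; apply: lspan_wspan (spanN (lspan_ractU (e b) p)) _.
by move=> u _; apply: letter_wlt.
Qed.

Lemma redex_lead_word t f :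
  redex t f -> lead le f (letter t) /\ f@_(letter t) = 1.
Proof.
case/redex_lead=> r rt ->; apply: lead_below => //.
by apply: lspan_wspan rt _ => u; apply: wlt_letter.
Qed.

Lemma Shat_redex t f : redex t f -> Shat le S f.
Proof.
move=> tf; left; elim: tf => [p b u|v {}t {}f _ [n IH]|{}t {}f v _ [n IH]].
- exists 0%N; split; first by apply/MWsetP; right; exists p, b, u.
  exists (letter (App p (App (Gen b) u))) => //.
  exact: (redex_lead_word (redexW p b u)).1.
- by exists n.+1, f, v; split=> //; left.
by exists n.+1, f, v; split=> //; right.
Qed.

Lemma Shat_Mgen p b : Shat le S (Mgen (monU p) (e b)).
Proof.
right; split; first by apply/MWsetP; left; exists p, b.
(* The principal word of M has two letters, so M is not in [S0]. *)
by case=> _ [w wf]; rewrite (lead_unique wf (Mgen_lead p b).1).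
Qed.

(** * Triviality of the compositions *)

Definition reduces (bound : word X -> Prop) : P -> Prop :=
  span (fun s => Shat le S s /\ exists2 w, lead le s w & bound w).

Lemma reduces_rspan (B : U -> Prop) (bound : word X -> Prop) f :
  rspan B f -> (forall u, B u -> bound (letter u)) -> reduces bound f.
Proof.
move=> Bf Bb; apply: span_sub Bf _ => s [t /Bb bt ts]; split.
  exact: Shat_redex ts.
by exists (letter t) => //; apply: (redex_lead_word ts).1.
Qed.

Lemma reduces_Mgen_basis (B : U -> Prop) (bound : word X -> Prop) f b :
  lspan B f -> (forall p, B p -> bound (mword p b)) ->
  reduces bound (Mgen f (e b)).
Proof.
move=> Bf Bb; apply: (span_map (Mgen_linear1 (e b)) Bf) => _ [p Bp ->].
apply: span_gen; split; first exact: Shat_Mgen.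
by exists (mword p b); [apply: (Mgen_lead p b).1 | apply: Bb].
Qed.

Lemma reduces_Mgen (bound : word X -> Prop) p y :
  (forall x, bound (mword p x)) -> reduces bound (Mgen (monU p) y).
Proof.
move=> Bb; apply: (span_map (Mgen_linear2 _) (basis_span y)) => _ [x ->].
by apply: reduces_Mgen_basis (lspan_eq p) _ => _ <-.
Qed.

(** With [t = f - r], the difference is [- M(r, b) - f ◁ b]. The first term has lower principal
    words, and the second is in the ideal by stability, hence built from letters below [t * b]. *)
Lemma reduces_Mgen_redex t b f : redex t f ->
  reduces (lt^~ (mword t b)) (Mgen (monU t) (e b) - f ⊛ gen b).
Proof.
move=> tf; have [r rt fE] := redex_lead tf.
have -> : Mgen (monU t) (e b) - f ⊛ gen b = - Mgen r (e b) - ract (e b) f.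
  have -> : monU t = f - r by rewrite fE addrK.
  rewrite /Mgen lin_gen_basis ractB starBl.
  by apply/malgP => w; rewrite !(mcoeffD, mcoeffN); ring.
apply: spanB; first apply: spanN.
  by apply: reduces_Mgen_basis rt _ => p pt; apply/wlt_mulr/wlt_letter.
by apply: reduces_rspan (redex_ract (e b) tf) _ => u _; apply: letter_wlt.
Qed.

(** The difference is [(p ◁ b) * c - p * (b.c)]. Reducing both terms by M leaves
    [(p ◁ b) ◁ c - p ◁ (b.c)], which is in the ideal by [ract_assoc]. *)
Lemma reduces_intersection p b c :
  reduces (lt^~ (wmul (letter p) (mword (Gen b) c)))
    (monU p ⊛ Mgen (monU (Gen b)) (e c) - Mgen (monU p) (e b) ⊛ monU (Gen c)).
Proof.
have -> : monU p ⊛ Mgen (monU (Gen b)) (e c)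
    - Mgen (monU p) (e b) ⊛ monU (Gen c) =
    Mgen (ractU (e b) p) (e c) - Mgen (monU p) (mul (e b) (e c))
    + (ract (e c) (ractU (e b) p) - ractU (mul (e b) (e c)) p).
  rewrite /Mgen !lin_gen_basis !ract_monU /= !starBr !starBl.
  rewrite starA.
  by apply/malgP => w; rewrite !(mcoeffD, mcoeffN); ring.
apply: spanD; first apply: spanB.
- apply: reduces_Mgen_basis (lspan_ractU _ _) _ => q _.
  by rewrite /mword wmulA; apply/wlt_mulr/letter_wlt.
- by apply: reduces_Mgen => x; apply/wlt_mull/letter_wlt.
by apply: reduces_rspan (ract_assoc _ _ _) _ => q _; apply: letter_wlt.
Qed.

(** Treats together the inclusions of types (C1) and (C3) in which the included polynomial comes
    from W. *)
Lemma reduces_inclusion f wf t s l r : S f -> lead le f wf -> redex t s ->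
  wf = wcat l (letter t) r -> reduces (lt^~ wf) (f - wact l s r).
Proof.
move=> /MWsetP[[p [b ->]]|[p [b [u ->]]]] fw ts.
  rewrite (lead_unique fw (Mgen_lead p b).1) => /(congr1 val) /=.
  case: l => [[-> <-]|q [|q' l] []] /=; last by case: l.
    by rewrite wact_rletter; apply: reduces_Mgen_redex.
  (* The second letter of [p * b] is a generator, so it cannot carry a redex. *)
  by move=> _ tE _; case: _ / tE ts => ts; inversion ts.
have W := redexW p b u.
rewrite (lead_unique fw (redex_lead_word W).1) => /(congr1 val) /=.
case: l => [[tE <-]|q [|q' l] []] //=.
rewrite wact_nil; case: _ / tE ts => ts.
by apply: reduces_rspan (redex_overlap ts) _ => v; apply: wlt_letter.
Qed.

Lemma reduces_composition f h s w :
  S f -> S h -> composition le f h s w -> reduces (lt^~ w) s.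
Proof.
move=> Sf Sh C; case: _ _ / C => [wf wh l r lf lh E|wf wh u v w' lf lh Ef Eh
  |wf t l r c lf lh _ E].
- case/MWsetP: (Sh) => [[p [b hE]]|[p [b [u hE]]]]; last first.
    have W := redexW p b u; rewrite -hE in W.
    apply: (reduces_inclusion Sf lf W).
    by rewrite E -(lead_unique lh (redex_lead_word W).1).
  (* Inclusion of an M: the principal word of [f] contains a two-letter word, so [f] is an M with
     the same [p] and [b], and the difference vanishes. *)
  have [lh' _] := Mgen_lead p b; rewrite -hE in lh'.
  have {E} := congr1 val E; rewrite (lead_unique lh lh') /= => E.
  case/MWsetP: Sf => [[p' [b' fE]]|[p' [b' [u fE]]]]; last first.
    have W := redexW p' b' u; rewrite -fE in W.
    move: E; rewrite (lead_unique lf (redex_lead_word W).1) /=.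
    by case: l => [|? []].
  have [lf' _] := Mgen_lead p' b'; rewrite -fE in lf'.
  move: E; rewrite (lead_unique lf lf') /=.
  case: l => [[pE bE <-]|q [|q' []]] //=.
  by rewrite wact_nil hE fE pE bE subrr; apply: span_zero.
- case/MWsetP: Sf => [[p [b fE]]|[p [b [x fE]]]]; last first.
    have W := redexW p b x; rewrite -fE in W.
    by have := wlen_wmul u v; rewrite -Ef (lead_unique lf (redex_lead_word W).1).
  case/MWsetP: Sh => [[p' [b' hE]]|[p' [b' [x hE]]]]; last first.
    have W := redexW p' b' x; rewrite -hE in W.
    by have := wlen_wmul w' u; rewrite -Eh (lead_unique lh (redex_lead_word W).1).
  have [lf' _] := Mgen_lead p b; rewrite -fE in lf'.
  have [lh' _] := Mgen_lead p' b'; rewrite -hE in lh'.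
  have wfE := lead_unique lf lf'; have whE := lead_unique lh lh'.
  (* Both polynomials are M, and the common factor [u] is at once the first letter of one principal
     word and the last letter of the other, so it is a generator. *)
  have [uE vE] := wmul_mword (etrans (esym Ef) wfE).
  have [w'E] := wmul_mword (etrans (esym Eh) whE).
  rewrite uE => -[pE]; rewrite wfE w'E vE hE fE pE.
  exact: reduces_intersection.
case/MWsetP: (Sh) => [[p [b hE]]|[p [b [u hE]]]].
  have [lh' _] := Mgen_lead p b; rewrite -hE in lh'.
  by have := lead_unique lh lh'.
have W := redexW p b u; rewrite -hE in W.
apply: (reduces_inclusion Sf lf (redex_plug c W)).
by rewrite E; have [->] := lead_unique lh (redex_lead_word W).1.
Qed.

(** Only M has a principal word with more than one letter. Its product with a letter on the right is
    a W and with a word on the left is again an M, so the composition presents itself. *)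
Lemma reduces_mul_composition f h : S f -> mul_composition le f h ->
  exists2 w, lead le h w & reduces (le^~ w) h.
Proof.
have self s w : Shat le S s -> lead le s w ->
    exists2 w, lead le s w & reduces (le^~ w) s.
  move=> Ss sw; exists w => //; apply: span_gen; split=> //.
  by exists w => //; apply: le_refl.
move=> /MWsetP[[p [b ->]]|[p [b [x ->]]]] [wf v fw w1|wf u fw w1]; last 2 first.
- by move: w1; rewrite (lead_unique fw (redex_lead_word (redexW p b x)).1).
- by move: w1; rewrite (lead_unique fw (redex_lead_word (redexW p b x)).1).
- rewrite Mgen_succ; have W := redexW p b v.
  by apply: self (Shat_redex W) (redex_lead_word W).1.
have [q ->] : exists q, mon u ≻ Mgen (monU p) (e b) = Mgen (monU q) (e b).
  move: u; apply: (word_indl (Q := fun g => exists q,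
    g ≻ Mgen (monU p) (e b) = Mgen (monU q) (e b))) => [u|u w [q IH]].
    by exists (App u p); rewrite succ_Mgen.
  by exists (App u q); rewrite succ_star IH succ_Mgen.
exact: self (Shat_Mgen q b) (Mgen_lead q b).1.
Qed.

Lemma MWset_monic f : S f -> is_monic le f.
Proof.
case/MWsetP=> [[p [b ->]]|[p [b [u ->]]]].
  by have [] := Mgen_lead p b; exists (mword p b).
by have [] := redex_lead_word (redexW p b u);
  exists (letter (App p (App (Gen b) u))).
Qed.

End RightAction.

Theorem theorem6 (k : fieldType) (A : lmodType k)
    (mul : {bilinear A -> A -> A}) (mulA : associative mul)
    (d : Order.disp_t) (X : orderType d)
    (X_wf : well_founded (fun x y : X => (x < y)%O))
    (e : X -> A) (he : linear_basis e)
    (le : rel (word X)) (hle : monomial_order le) :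
  is_GSB le (MWset mul he).
Proof.
split=> [f|f g h w Sf Sg C|f h Sf C]; first exact: MWset_monic.
  exact/presentable_span/(reduces_composition mulA hle Sf Sg C).
(* These compositions are again M or W, hence nonzero, so the second alternative always holds. *)
right; have [w hw hP] := reduces_mul_composition hle Sf C.
by exists w => //; apply: presentable_span.
Qed.
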